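(* Suppose Assumptions 1, 2, 3 and 4'' (stated in the context, with the block decomposition given there) hold. Let $x=(x_1,x_2)$, with $x_1\in\mathbb{R}^q$ and $x_2\in\mathbb{R}^{n-q}$, be a solution of $$\dot x=Ax+B\omega+f_1(x,u)+f_2(x,u)\theta(t),\qquad \omega\in-\mathcal{F}(Cx),\qquad y=Fx=F_qx_1,$$ and let $\tilde z$ (with values in $\mathbb{R}^{n-q}$) be a solution of $$\dot{\tilde z}=(A_{22}+KA_{12})\tilde z+(B_2+KB_1)\tilde\omega+\big[(A_{21}+KA_{11})-(A_{22}+KA_{12})K\big]x_1+(K\;\;I_{n-q})\,f_1\!\left(\begin{pmatrix} x_1 \\ \tilde z-Kx_1 \end{pmatrix},u\right),$$ $$\tilde\omega\in-\mathcal{F}\big(C_2\tilde z+(C_1-C_2K)x_1\big),\qquad \tilde x_2=\tilde z-Kx_1,$$ where $K=P_{22}^{-1}P_{21}$. Then this system is a reduced-order observer of the original system, i.e. $\lim_{t\to\infty}(x_2(t)-\tilde x_2(t))=0$.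
   Context: Data: $A\in\mathbb{R}^{n\times n}$, $B\in\mathbb{R}^{n\times m}$, $C\in\mathbb{R}^{m\times n}$, $F\in\mathbb{R}^{q\times n}$ are given matrices; $u\in\mathbb{R}^r$ is the control input, $y$ the measurable output; $\mathcal{F}:\mathbb{R}^m\rightrightarrows\mathbb{R}^m$ is a set-valued map; $f_1:\mathbb{R}^n\times\mathbb{R}^r\to\mathbb{R}^n$ and $f_2:\mathbb{R}^n\times\mathbb{R}^r\to\mathbb{R}^{n\times l}$ are known functions; $\theta(t)\in\mathbb{R}^l$ is unknown. Norms are Euclidean (and the induced operator norms for matrices). A square matrix $Q$ is called positive definite, written $Q>0$, if there is $a>0$ with $\langle Qx,x\rangle\ge a\|x\|^2$ for all $x$. Block decomposition (with $x_1\in\mathbb{R}^q$, $x_2\in\mathbb{R}^{n-q}$): $x=\begin{pmatrix} x_1 \\ x_2 \end{pmatrix}$, $A=\begin{pmatrix} A_{11} & A_{12} \\ A_{21} & A_{22} \end{pmatrix}$, $B=\begin{pmatrix} B_1 \\ B_2 \end{pmatrix}$, $C=(C_1\;\;C_2)$, $F=(F_q\;\;0)$ with $F_q\in\mathbb{R}^{q\times q}$ invertible. Assumption 1: $\mathcal{F}$ is monotone (i.e. $\langle x^*-y^*,x-y\rangle\ge0$ whenever $x^*\in\mathcal{F}(x)$, $y^*\in\mathcal{F}(y)$) and upper semi-continuous with non-empty, closed, convex and bounded values. Assumption 2: $f_1,f_2$ are continuous and Lipschitz in $x$: there are $L_1>0$, $L_2>0$ such that for all $x,x'\in\mathbb{R}^n$,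 $u\in\mathbb{R}^r$, $\|f_1(x,u)-f_1(x',u)\|\le L_1\|x-x'\|$ and $\|f_2(x,u)-f_2(x',u)\|\le L_2\|x-x'\|$. Assumption 3: $\theta$ is continuous and bounded by some $L_3>0$, i.e. $\|\theta(t)\|\le L_3$ for all $t$. Assumption 4'': There exist $\epsilon>0$, $Q\in\mathbb{R}^{(n-q)\times(n-q)}$ with $Q>0$, an invertible $P_{22}\in\mathbb{R}^{(n-q)\times(n-q)}$ and $P_{21}\in\mathbb{R}^{(n-q)\times q}$ such that, with $K=P_{22}^{-1}P_{21}$, $Q(A_{22}+KA_{12})+(A_{22}+KA_{12})^TQ+L_1Q(KK^T+I_{n-q})Q+(L_1+\epsilon)I_{n-q}\le0$ (negative semidefinite), $(B_2+KB_1)^TQ=C_2$, and $(P_{21}\;\;P_{22})f_2(x,u)=0$ for all $(x,u)$. Solutions are absolutely continuous functions of time on $[0,+\infty)$ satisfying the system for almost every $t$, with selections $\omega(t)$, resp. $\tilde\omega(t)$, from the indicated sets.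
   Formalization: The matrix Q in Assumption 4'' is additionally required to be symmetric; with the stated definition of Q>0, which allows non-symmetric Q, the convergence claim is false. *)

(* Defs.v *)
From HB Require Import structures.
From mathcomp Require Export all_boot all_order all_algebra.
From mathcomp Require Export all_classical all_reals all_analysis.

Set Implicit Arguments.
Unset Strict Implicit.
Unset Printing Implicit Defensive.

Export Order.TTheory GRing.Theory Num.Theory.
Export numFieldNormedType.Exports.

Local Open Scope classical_set_scope.
Local Open Scope ring_scope.

Definition inner (R : realType) n (x y : 'cV[R]_n) : R := (x^T *m y) 0 0.

(* The library norm [`|x|] on matrices is the sup norm; quantitative bounds
   below use the Euclidean norm.  Topological notions (open, continuous,
   bounded, limits, derivatives) are insensitive to the choice. *)
Definition enorm (R : realType) n (x : 'cV[R]_n) : R := Num.sqrt (inner x x).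

Definition opnorm (R : realType) m n (M : 'M[R]_(m, n)) : R :=
  sup [set enorm (M *m v) | v in [set v : 'cV[R]_n | enorm v <= 1]].

(* Symmetry is not part of this definition. *)
Definition posdef (R : realType) n (Q : 'M[R]_n) : Prop :=
  exists2 a : R, 0 < a & forall x, a * enorm x ^+ 2 <= inner (Q *m x) x.

Definition negsemidef (R : realType) n (M : 'M[R]_n) : Prop :=
  forall x, inner (M *m x) x <= 0.

Definition monotone_map (R : realType) n
    (F : 'cV[R]_n -> set 'cV[R]_n) : Prop :=
  forall x y xs ys, F x xs -> F y ys -> 0 <= inner (xs - ys) (x - y).

Definition upper_semicontinuous (S T : topologicalType) (F : S -> set T) :
    Prop :=
  forall x (V : set T), open V -> F x `<=` V -> \forall y \near x, F y `<=` V.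

Definition admissible_map (R : realType) m
    (F : 'cV[R]_m -> set 'cV[R]_m) : Prop :=
  [/\ monotone_map F, upper_semicontinuous F &
      forall x, [/\ F x !=set0, closed (F x), convex_set (F x) &
                    bounded_set (F x)]].

Definition admissible_nonlinearities (R : realType) n r l
    (f1 : 'cV[R]_n -> 'cV[R]_r -> 'cV[R]_n)
    (f2 : 'cV[R]_n -> 'cV[R]_r -> 'M[R]_(n, l)) (L1 L2 : R) : Prop :=
  [/\ continuous (fun p : 'cV[R]_n * 'cV[R]_r => f1 p.1 p.2),
      continuous (fun p : 'cV[R]_n * 'cV[R]_r => f2 p.1 p.2),
      0 < L1 /\ (forall x x' u,
        enorm (f1 x u - f1 x' u) <= L1 * enorm (x - x')) &
      0 < L2 /\ (forall x x' u,
        opnorm (f2 x u - f2 x' u) <= L2 * enorm (x - x'))].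

Definition bounded_signal (R : realType) l (theta : R -> 'cV[R]_l) (L3 : R) :
    Prop :=
  [/\ {within `[0, +oo[, continuous theta}, 0 < L3 &
      forall t, 0 <= t -> enorm (theta t) <= L3].

(* The state space R^n is split as n = q + p, so that the library's block
   projections give the decomposition of A, B, C. *)
Definition observer_lmi (R : realType) q p m r l
    (A : 'M[R]_(q + p)) (B : 'M[R]_(q + p, m)) (C : 'M[R]_(m, q + p))
    (f2 : 'cV[R]_(q + p) -> 'cV[R]_r -> 'M[R]_(q + p, l)) (L1 eps : R)
    (Q P22 : 'M[R]_p) (P21 : 'M[R]_(p, q)) : Prop :=
  let K := invmx P22 *m P21 in
  let N := drsubmx A + K *m ursubmx A in
  [/\ 0 < eps,
      (* In the matrix inequality Q is a symmetric Lyapunov matrix; dropping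
         Q^T = Q makes the convergence result false. *)
      Q^T = Q /\ posdef Q,
      P22 \in unitmx,
      negsemidef (Q *m N + N^T *m Q
                  + L1 *: (Q *m (K *m K^T + 1%:M) *m Q)
                  + (L1 + eps)%:M) &
      (dsubmx B + K *m usubmx B)^T *m Q = rsubmx C /\
      (forall x u, row_mx P21 P22 *m f2 x u = 0)].

Definition abs_continuous (R : realType) n (a b : R) (x : R -> 'cV[R]_n) :
    Prop :=
  forall e : R, 0 < e -> exists2 d : R, 0 < d &
    forall (k : nat) (s t : 'I_k -> R),
      (forall i, [/\ a <= s i, s i <= t i & t i <= b]) ->
      (forall i j, i != j -> t i <= s j \/ t j <= s i) ->
      \sum_i (t i - s i) < d ->
      \sum_i enorm (x (t i) - x (s i)) < e.

(* Signals are total functions of which only the values on [0, +oo[ matter.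
   As usual for differential inclusions, absolute continuity on the half-line
   means absolute continuity on every compact subinterval. *)
Definition abs_continuous_halfline (R : realType) n (x : R -> 'cV[R]_n) :
    Prop :=
  forall T : R, 0 <= T -> abs_continuous 0 T x.

(* Main.v *)
(** With [G = (K I)], the error [E = G x - z] obeys
    [E' = N E + (B2 + K B1) (omega - omega') + G (f1 (x, u) - f1 (x~, u))]:
    the unknown [theta] disappears because [G f2 = 0].  For the Lyapunov
    function [V = <Q E, E>], monotonicity of the set-valued map makes the
    [omega] term nonpositive and AM-GM absorbs the Lipschitz term into the
    matrix inequality, so [V' <= - eps |E|^2 <= - k V] almost everywhere.  An
    absolutely continuous function whose derivative is almost everywhere [<= c]
    grows at rate at most [c]; hence [V] is nonincreasing, and then
    [V t + k t V t <= V 0], which forces [E] to [0]. *)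
Require Import Defs.
From mathcomp Require Import ring lra.
From mathcomp Require Import measurable_realfun.

Local Open Scope classical_set_scope.
Local Open Scope ring_scope.

(** * Euclidean inner product and norm on column vectors *)

Section Euclidean.
Context {R : realType}.

Lemma innerE {n} (x y : 'cV[R]_n) : inner x y = \sum_i x i 0 * y i 0.
Proof. by rewrite /inner mxE; apply: eq_bigr => i _; rewrite mxE. Qed.

Lemma innerC {n} (x y : 'cV[R]_n) : inner x y = inner y x.
Proof. by rewrite !innerE; apply: eq_bigr => i _; rewrite mulrC. Qed.

Lemma innerDl {n} (x y z : 'cV[R]_n) : inner (x + y) z = inner x z + inner y z.
Proof. by rewrite /inner linearD mulmxDl mxE. Qed.

Lemma innerZl {n} a (x y : 'cV[R]_n) : inner (a *: x) y = a * inner x y.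
Proof. by rewrite /inner linearZ -scalemxAl mxE. Qed.

Lemma innerNl {n} (x y : 'cV[R]_n) : inner (- x) y = - inner x y.
Proof. by rewrite -scaleN1r innerZl mulN1r. Qed.

Lemma innerDr {n} (x y z : 'cV[R]_n) : inner z (x + y) = inner z x + inner z y.
Proof. by rewrite innerC innerDl !(innerC _ z). Qed.

Lemma innerZr {n} a (x y : 'cV[R]_n) : inner x (a *: y) = a * inner x y.
Proof. by rewrite innerC innerZl innerC. Qed.

Lemma innerNr {n} (x y : 'cV[R]_n) : inner x (- y) = - inner x y.
Proof. by rewrite innerC innerNl innerC. Qed.

Lemma inner_trmx {m n} (M : 'M[R]_(m, n)) x y :
  inner (M^T *m x) y = inner x (M *m y).
Proof. by rewrite /inner trmx_mul trmxK mulmxA. Qed.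

Lemma inner_ge0 {n} (x : 'cV[R]_n) : 0 <= inner x x.
Proof. by rewrite innerE sumr_ge0 // => i _; rewrite -expr2 sqr_ge0. Qed.

Lemma enorm_ge0 {n} (x : 'cV[R]_n) : 0 <= enorm x.
Proof. exact: sqrtr_ge0. Qed.

Lemma enorm_sqr {n} (x : 'cV[R]_n) : enorm x ^+ 2 = inner x x.
Proof. by rewrite sqr_sqrtr // inner_ge0. Qed.

Lemma enormN {n} (x : 'cV[R]_n) : enorm (- x) = enorm x.
Proof. by rewrite /enorm innerNl innerNr opprK. Qed.

(** Cauchy-Schwarz: for nonzero [y], the squared norm of [inner y y *: x - inner x y *: y] is
    [inner y y] times the gap between the two squared sides. *)
Lemma inner_le_enorm {n} (x y : 'cV[R]_n) : inner x y <= enorm x * enorm y.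
Proof.
have [y0|yN0] := eqVneq (inner y y) 0.
  have y_eq0 i : y i 0 = 0.
    move: y0; rewrite innerE => /eqP; rewrite psumr_eq0 => [|j _]; last first.
      by rewrite -expr2 sqr_ge0.
    by move=> /allP/(_ i (mem_index_enum _))/=; rewrite mulf_eq0 orbb => /eqP.
  rewrite innerE big1 => [|i _]; last by rewrite y_eq0 mulr0.
  by rewrite mulr_ge0 ?enorm_ge0.
have y_gt0 : 0 < inner y y by rewrite lt_def yN0 inner_ge0.
apply: le_trans (ler_norm _) _; rewrite -(ler_pXn2r (n := 2)) ?nnegrE //; last first.
  by rewrite mulr_ge0 ?enorm_ge0.
rewrite exprMn !enorm_sqr real_normK ?num_real//.
have := inner_ge0 (inner y y *: x - inner x y *: y).
rewrite innerDl !innerDr !(innerNl, innerNr, innerZl, innerZr) (innerC y x).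
move=> h; suff : 0 <= inner y y * (inner x x * inner y y - inner x y ^+ 2).
  by rewrite pmulr_rge0 // subr_ge0.
by apply: le_trans h _; rewrite le_eqVlt; apply/orP; left; apply/eqP; ring.
Qed.

Lemma abs_inner_le_enorm {n} (x y : 'cV[R]_n) :
  `|inner x y| <= enorm x * enorm y.
Proof.
rewrite ler_norml inner_le_enorm andbT lerNl -innerNl.
by rewrite (le_trans (inner_le_enorm _ _)) // enormN.
Qed.

Lemma enormD {n} (x y : 'cV[R]_n) : enorm (x + y) <= enorm x + enorm y.
Proof.
rewrite -(ler_pXn2r (n := 2)) ?nnegrE ?addr_ge0 ?enorm_ge0 //.
rewrite sqrrD !enorm_sqr innerDl !innerDr (innerC y x).
have := inner_le_enorm x y; lra.
Qed.

(** The constant is the Frobenius norm of [M]: Cauchy-Schwarz is applied to each row. *)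
Lemma enorm_mulmx_le {m n} (M : 'M[R]_(m, n)) :
  exists2 c, 0 <= c & forall v, enorm (M *m v) <= c * enorm v.
Proof.
exists (Num.sqrt (\sum_i enorm (row i M)^T ^+ 2)); first exact: sqrtr_ge0.
have S0 : 0 <= \sum_i enorm (row i M)^T ^+ 2.
  by rewrite sumr_ge0 // => i _; rewrite sqr_ge0.
move=> v; rewrite -(ler_pXn2r (n := 2)) ?nnegrE ?mulr_ge0 ?enorm_ge0 ?sqrtr_ge0 //.
rewrite exprMn (sqr_sqrtr S0) enorm_sqr innerE mulr_suml ler_sum // => i _.
have -> : (M *m v) i 0 = inner (row i M)^T v.
  by rewrite innerE mxE; apply: eq_bigr => j _; rewrite !mxE.
rewrite -expr2 -real_normK ?num_real // -exprMn.
by rewrite ler_pXn2r ?nnegrE ?mulr_ge0 ?enorm_ge0 // abs_inner_le_enorm.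
Qed.

Lemma coord_le_enorm {n} (x : 'cV[R]_n) i : `|x i 0| <= enorm x.
Proof.
rewrite -(ler_pXn2r (n := 2)) ?nnegrE ?enorm_ge0 //.
rewrite enorm_sqr innerE (bigD1 i) //= real_normK ?num_real // -expr2 lerDl.
by rewrite sumr_ge0 // => j _; rewrite -expr2 sqr_ge0.
Qed.

Lemma norm_le_enorm {n} (x : 'cV[R]_n) : `|x| <= enorm x.
Proof.
rewrite [`|x|]mx_normrE; apply/bigmax_leP; split => [|[i j] _] /=.
  exact: enorm_ge0.
by rewrite ord1 coord_le_enorm.
Qed.

Lemma enorm_col_mx0 {m n} (v : 'cV[R]_n) :
  enorm (col_mx (0 : 'cV[R]_m) v) = enorm v.
Proof. by rewrite /enorm /inner tr_col_mx mul_row_col trmx0 mul0mx add0r. Qed.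

End Euclidean.

(** * Product rule for matrix-valued functions of time *)

Section Calculus.
Context {R : realType}.

Lemma is_derive_mxP {m n} (M : R -> 'M[R]_(m, n)) (t v : R) dM :
  is_derive t v M dM <->
  forall i j, is_derive t v (fun s => M s i j) (dM i j).
Proof.
split=> [[dM1 dM2] i j|H].
  split; first exact: (derivable_mxP M t v).1 dM1 i j.
  by rewrite -dM2 derive_mx // mxE.
have dM1 : derivable M t v by apply: (derivable_mxP M t v).2 => i j; case: (H i j).
split=> //; rewrite derive_mx //; apply/matrixP => i j.
by rewrite mxE; case: (H i j).
Qed.

Lemma is_derive_trmx {m n} {M : R -> 'M[R]_(m, n)} {t v : R} {dM} :
  is_derive t v M dM -> is_derive t v (fun s => (M s)^T) dM^T.
Proof.
move=> /is_derive_mxP H; apply/is_derive_mxP => i j; rewrite mxE.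
by under eq_fun do rewrite mxE.
Qed.

Lemma is_derive_mulmx {m n k} {M : R -> 'M[R]_(m, n)} {N : R -> 'M[R]_(n, k)}
    {t v : R} {dM dN} :
  is_derive t v M dM -> is_derive t v N dN ->
  is_derive t v (fun s => M s *m N s) (dM *m N t + M t *m dN).
Proof.
move=> /is_derive_mxP HM /is_derive_mxP HN; apply/is_derive_mxP => i j.
have -> : (fun s => (M s *m N s) i j) =
    \sum_l ((fun s => M s i l) * (fun s => N s l j)).
  by apply/funext => s; rewrite mxE fct_sumE.
apply: (@is_derive_eq _ _ _ _ _ _ _ _ (is_derive_sum _)).
rewrite !mxE -big_split; apply: eq_bigr => l _.
by rewrite /= addrC; congr (_ + _); rewrite /GRing.scale /= mulrC.
Qed.

Lemma is_derive_mulmxl {m n k} (A : 'M[R]_(m, n)) {M : R -> 'M[R]_(n, k)}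
    {t v : R} {dM} :
  is_derive t v M dM -> is_derive t v (fun s => A *m M s) (A *m dM).
Proof.
move=> HM.
by have := is_derive_mulmx (is_derive_cst A t v) HM; rewrite mul0mx add0r.
Qed.

End Calculus.

(** * Absolute continuity and growth under almost everywhere derivative bounds *)

Section AbsoluteContinuity.
Context {R : realType}.
Local Notation mu := (@lebesgue_measure R).

(* Cousin's lemma in the form of an induction principle. *)
Lemma gauge_induction (S : set R) (a b : R) : a <= b -> S a ->
  (forall c, a <= c <= b -> exists2 r, 0 < r & forall s t, S s ->
     a <= s -> c - r < s -> s <= c -> c <= t -> t < c + r -> t <= b -> S t) ->
  S b.
Proof.
move=> ab Sa step; pose D := [set t | S t /\ a <= t <= b].
have Da : D a by split; rewrite // lexx.
have ubD : ubound D b by move=> t [_ /andP[]].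
have supD : has_sup D by split; [exists a|exists b].
have cb : sup D <= b by apply: ge_sup; first exists a.
have leD : ubound D (sup D) by apply: ub_le_sup; exists b.
have [r r0 ext] := step (sup D) ltac:(by rewrite cb leD).
have [s [Ss /andP[as_ sb]] cs] := sup_adherent r0 supD.
have sc : s <= sup D by apply: leD; split; rewrite ?as_.
(* The half-radius keeps [t] inside the gauge at [sup D]; as [t] cannot exceed [sup D], the minimum
   must be [b]. *)
pose t := Order.min b (sup D + r / 2).
have r20 : 0 < r / 2 by rewrite divr_gt0.
have ct : sup D <= t by rewrite /t le_min cb lerDl ltW.
have St : S t.
  apply: (ext s) => //; last by rewrite /t ge_min lexx.
  by rewrite /t gt_min ltrD2l; apply/orP; right; lra.
have : t <= sup D.
  apply: leD; split => //; rewrite (le_trans as_ (le_trans sc ct)).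
  by rewrite /t ge_min lexx.
rewrite /t ge_min => /orP[bc|]; last by rewrite gerDl leNgt r20.
suff <- : t = b by [].
by rewrite /t min_l // (le_trans bc) // lerDl ltW.
Qed.

(** By Caratheodory, the slope of [g] from [c] is continuous at [c] with value [d < k], hence stays
    below [k] nearby. The estimates over [[s, c]] and [[c, t]] add up because [c] lies between [s]
    and [t]. *)
Lemma derive_le_gauge (g : R -> R) (c d k : R) : is_derive c 1 g d -> d < k ->
  exists2 r, 0 < r & forall s t, c - r < s -> s <= c -> c <= t -> t < c + r ->
    g t - g s <= k * (t - s).
Proof.
move=> /is_derive1_caratheodory[h [hE hc hcd]] dk.
have : \forall s \near c, h s < k.
  by apply: (hc) (lt_nbhsl _); rewrite hcd.
rewrite -nbhs_nearE => -[r /= r0 hr]; exists r => // s t rs sc ct tr.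
have slope_le z : `|c - z| < r -> h z <= k by move=> /hr /ltW.
have : h t * (t - c) <= k * (t - c).
  by rewrite ler_wpM2r ?subr_ge0 // slope_le // ltr_norml; lra.
have : h s * (c - s) <= k * (c - s).
  by rewrite ler_wpM2r ?subr_ge0 // slope_le // ltr_norml; lra.
have := hE t; have := hE s.
lra.
Qed.

(** Additivity over disjoint pieces, the half-open interval keeping [s] from being counted twice.
    This pays for each interval added in the covering argument below. *)
Lemma lebesgue_measure_extend (U : set R) (a s t : R) :
  measurable U -> a <= s -> s <= t -> `]s, t] `<=` U ->
  (mu (U `&` `[a, s]) + (t - s)%:E <= mu (U `&` `[a, t]))%E.
Proof.
move=> mU as_ st stU.
have mi (i : interval R) : measurable [set` i] by exact: measurable_itv.
have -> : (t - s)%:E = mu `]s, t].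
  rewrite lebesgue_measure_itv /= lte_fin.
  case: ltP => [_|ts]; first by rewrite EFinB.
  by have -> : t = s by [apply/le_anti/andP]; rewrite subrr.
rewrite -measureU //; last 2 first.
- exact: measurableI.
- apply/seteqP; split => // x [[_ /=]]; rewrite !in_itv /= => /andP[_ xs] /andP[].
  by rewrite ltNge xs.
apply: le_measure; rewrite ?inE; try by apply: measurableI.
  by apply: measurableU => //; exact: measurableI.
move=> x [[Ux]|xst]; rewrite /= ?in_itv /=.
  by move=> /andP[ax xs]; split; rewrite // ax (le_trans xs).
split; first exact: stU.
move: xst; rewrite /= !in_itv /= => /andP[sx ->].
by rewrite (le_trans as_) // ltW.
Qed.

(** Outer regularity of Lebesgue measure around a measurable null superset of [N]. *)
Lemma null_set_open_cover (N : set R) (d : R) : mu.-negligible N -> 0 < d ->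
  exists U, [/\ open U, N `<=` U & (mu U < d%:E)%E].
Proof.
move=> [A [mA A0 NA]] d0.
have muA : mu A = 0%E by exact: A0.
have [|U [oU AU UA]] := lebesgue_regularity_outer mA _ d0.
  by rewrite [X in (X < _)%E]muA ltry.
exists U; split => //; first exact: subset_trans AU.
have mU : measurable U by exact: open_measurable.
by rewrite (measureDI mu mU mA) (setIidr AU) [X in (_ + X)%E]muA adde0.
Qed.

(** The bad times lie in an open [U] of tiny measure. Near points of [U] the absolute continuity of
    [X] controls [g], near other points the derivative does, and gauge induction glues the local
    estimates. Asking of [g] only a bound by increments of [X] lets a quadratic form of a bounded
    [X] fit directly. *)
Lemma abs_continuous_derive_le {n} (X : R -> 'cV[R]_n) (g : R -> R)
    (a b k M : R) : a <= b -> 0 <= M -> abs_continuous a b X ->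
  (forall s t, a <= s -> s <= t -> t <= b ->
    g t - g s <= M * enorm (X t - X s)) ->
  {ae mu, forall t, a <= t <= b -> exists2 d, is_derive t 1 g d & d <= k} ->
  g b - g a <= k * (b - a).
Proof.
move=> ab M0 acX gX gk; apply/ler_addgt0Pr => e e0.
(* [eta], [e'] and [d1] each claim a third of the slack [e]: for the excess slope, for the
   increments of [X] over the intervals in [U], and for their total length. The [+ 1] in each
   denominator avoids division by zero. *)
pose eta := e / 3 / (b - a + 1).
have eta0 : 0 < eta by rewrite !divr_gt0 //; lra.
have etaP : eta * (b - a) <= e / 3.
  by rewrite /eta mulrAC ler_pdivrMr ?ler_pM2l; lra.
pose e' := e / 3 / (M + 1).
have e'0 : 0 < e' by rewrite !divr_gt0 //; lra.
have e'P : M * e' <= e / 3.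
  by rewrite /e' mulrC mulrAC ler_pdivrMr ?ler_pM2l; lra.
have [d d0 acd] := acX _ e'0.
pose d1 := e / 3 / (`|k| + 1).
have k1 : 0 < `|k| + 1 by rewrite ltr_wpDl.
have d10 : 0 < d1 by rewrite !divr_gt0.
have d1P : `|k| * d1 <= e / 3.
  by rewrite /d1 mulrC mulrAC ler_pdivrMr // ler_pM2l ?lerDl // divr_gt0.
have d20 : 0 < Order.min d d1 by rewrite lt_min d0.
have [U [oU NU Ud]] := null_set_open_cover _ _ gk d20.
have mU : measurable U by exact: open_measurable.
(* [S t]: the increment of [g] over [a, t] is controlled by the derivative
   except on finitely many nonoverlapping intervals [u i, v i], covered by [U]
   and hence of small total length. *)
pose S t := exists m (u v : nat -> R),
  [/\ forall i, (i < m)%N -> [/\ a <= u i, u i <= v i & v i <= t],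
      forall i j, (i < m)%N -> (j < m)%N -> i != j -> v i <= u j \/ v j <= u i,
      ((\sum_(i < m) (v i - u i))%:E <= mu (U `&` `[a, t]))%E &
      g t - g a <= (k + eta) * (t - a) +
        (M * \sum_(i < m) enorm (X (v i) - X (u i)) +
         `|k| * \sum_(i < m) (v i - u i))].
have : S b.
  apply: (gauge_induction S a b) => //.
    exists 0%N, (fun=> 0), (fun=> 0); rewrite !big_ord0 !subrr !mulr0 !addr0.
    by split => //; exact: measure_ge0.
  move=> c /andP[ac cb].
  (* If [c] is in [U], a neighbourhood of [c] is too, and [[s, t]] is appended to the list at index
     [m]. Otherwise the list is kept and the derivative at [c] bounds the increment of [g] with
     slope [k + eta]. *)
  have [Uc|nUc] := pselect (U c).
    have [r /= r0 rU] : nbhs c U by exact: open_nbhs_nbhs.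
    exists r => // s t [m [u [v [uvs uvd lenU gs]]]] as_ rs sc ct tr tb.
    have st := le_trans sc ct.
    exists m.+1, (fun i => if i == m then s else u i),
      (fun i => if i == m then t else v i).
    have lt_neq (i : 'I_m) : (i == m :> nat) = false by rewrite ltn_eqF.
    split.
    - move=> i; rewrite ltnS leq_eqVlt; case: eqVneq => [_ _|_ /= /uvs[? ? vs]].
        by rewrite as_ st.
      by split => //; exact: le_trans st.
    - move=> i j; rewrite !ltnS (leq_eqVlt i) (leq_eqVlt j).
      case: eqVneq => [->|_]; case: eqVneq => [->|_] //=; rewrite ?eqxx //.
      + by move=> _ /uvs[_ _ ?] _; right.
      + by move=> /uvs[_ _ ?] _ _; left.
      + exact: uvd.
    - rewrite big_ord_recr /= eqxx EFinD; under eq_bigr do rewrite lt_neq.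
      apply: le_trans (lebesgue_measure_extend U a s t mU as_ st _).
        by rewrite leeD2r.
      move=> x /=; rewrite in_itv /= => /andP[sx xt]; apply: rU => /=.
      by rewrite ltr_norml; lra.
    - rewrite !big_ord_recr /= eqxx.
      under eq_bigr do rewrite lt_neq.
      under [X in `|k| * (X + _)]eq_bigr do rewrite lt_neq.
      have := gX s t as_ st tb.
      (* For negative [k] the slope term may shrink the bound over [[s, t]], where no derivative
         estimate is available; the term in [|k|] of [S] compensates. *)
      have : 0 <= (`|k| + (k + eta)) * (t - s).
        by rewrite mulr_ge0 ?subr_ge0 //; have := ler_norm (- k); rewrite normrN; lra.
      set Sx := \sum_(i < m) enorm _ in gs *; set Sl := \sum_(i < m) _ in gs *.
      lra.
  have [d' gd' d'k] : exists2 d, is_derive c 1 g d & d <= k.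
    by apply: contrapT => nd; apply/nUc/NU => /(_ _); rewrite ac cb => /(_ isT).
  have [r r0 gr] := derive_le_gauge g c d' (k + eta) gd' ltac:(lra).
  exists r => // s t [m [u [v [uvs uvd lenU gs]]]] as_ rs sc ct tr tb.
  have st := le_trans sc ct.
  exists m, u, v; split => //.
  - by move=> i /uvs[? ? vs]; split => //; exact: le_trans st.
  - apply: le_trans lenU _; apply: le_measure; rewrite ?inE.
    + exact: measurableI.
    + exact: measurableI.
    + apply: setIS => x /=; rewrite !in_itv /= => /andP[-> xs].
      exact: le_trans st.
  - have := gr s t rs sc ct tr; lra.
move=> [m [u [v [h1 h2 h3 h4]]]].
(* The total length is at most the measure of [U], hence small enough both for the absolute
   continuity of [X] and for the term in [|k|]. *)
have lensum : \sum_(i < m) (v i - u i) < Order.min d d1.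
  rewrite -lte_fin (le_lt_trans h3) // (le_lt_trans _ Ud) //.
  by apply: le_measure; rewrite ?inE //; exact: measurableI.
move: lensum; rewrite lt_min => /andP[lensum lensum1].
have := acd m (fun i => u i) (fun i => v i) (fun i => h1 _ (ltn_ord i))
  (fun i j ij => h2 _ _ (ltn_ord i) (ltn_ord j) ij) lensum.
move=> /ltW /(ler_wpM2l M0).
have := ler_wpM2l (normr_ge0 k) (ltW lensum1).
set Sx := \sum_(i < m) enorm _ in h4 *; set Sl := \sum_(i < m) _ in h4 *.
lra.
Qed.

Lemma abs_continuous_subitv {n} (X : R -> 'cV[R]_n) (a b a' b' : R) :
  a <= a' -> b' <= b -> abs_continuous a b X -> abs_continuous a' b' X.
Proof.
move=> aa bb acX e /acX[d d0 acd]; exists d => // m s t H.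
by apply: acd => i; have [? ? ?] := H i; split; lra.
Qed.

Lemma abs_continuous_lipschitz2 {n m k} (X : R -> 'cV[R]_n) (Y : R -> 'cV[R]_m)
    (Z : R -> 'cV[R]_k) (a b c : R) : 0 <= c ->
  (forall s t, enorm (Z t - Z s) <= c * (enorm (X t - X s) + enorm (Y t - Y s))) ->
  abs_continuous a b X -> abs_continuous a b Y -> abs_continuous a b Z.
Proof.
(* Each of the two sums contributes at most [c * e']; taking [2 * c + 1] keeps the final inequality
   strict and allows [c = 0]. *)
move=> c0 ZXY acX acY e e0; pose e' := e / (2 * c + 1).
have e'0 : 0 < e' by rewrite divr_gt0 //; lra.
have [d1 d10 ac1] := acX _ e'0; have [d2 d20 ac2] := acY _ e'0.
exists (Order.min d1 d2); first by rewrite lt_min d10.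
move=> j s t st st'; rewrite lt_min.
move=> /andP[/(ac1 _ _ _ st st') h1 /(ac2 _ _ _ st st') h2].
have : \sum_i enorm (Z (t i) - Z (s i)) <=
    c * (\sum_i enorm (X (t i) - X (s i)) + \sum_i enorm (Y (t i) - Y (s i))).
  by rewrite -big_split mulr_sumr ler_sum.
move=> /le_lt_trans; apply.
have -> : e = (2 * c + 1) * e' by rewrite /e' mulrC divfK // gt_eqF //; lra.
nra.
Qed.

(** At tolerance 1 the norm grows by at most 1 over a step shorter than [d], and [[a, b]] is crossed
    in finitely many steps of length [d / 2]. *)
Lemma abs_continuous_bounded {n} (X : R -> 'cV[R]_n) (a b : R) : a <= b ->
  abs_continuous a b X ->
  exists2 c, 0 <= c & forall t, a <= t <= b -> enorm (X t) <= c.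
Proof.
move=> ab acX; have [d d0 acd] := acX 1 ltr01.
have step s t : a <= s -> s <= t -> t <= b -> t - s < d ->
    enorm (X t) <= enorm (X s) + 1.
  move=> as_ st tb tsd.
  have := acd 1%N (fun=> s) (fun=> t) (fun=> And3 as_ st tb).
  rewrite !big_ord1 => /(_ _ tsd) h; rewrite -{1}(subrK (X s) (X t)).
  rewrite addrC (le_trans (enormD _ _)) // lerD2l ltW // h // => i j.
  by rewrite !ord1 eqxx.
have bnd k t : a <= t <= b -> t - a <= k%:R * (d / 2) ->
    enorm (X t) <= enorm (X a) + k%:R.
  elim: k t => [|k IH] t /andP[at_ tb] tk.
    have -> : t = a by apply/le_anti; rewrite at_ andbT -subr_le0 (le_trans tk) ?mul0r.
    by rewrite addr0.
  have [ta|ta] := leP (t - a) (d / 2).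
    rewrite (le_trans (step a t _ _ _ _)) ?lexx //; first lra.
    by rewrite lerD2l ler1n.
  have := IH (t - d / 2); rewrite -natr1 in tk *.
  have := step (t - d / 2) t; lra.
exists (enorm (X a) + (Num.truncn ((b - a) / (d / 2))).+1%:R).
  by rewrite addr_ge0 ?enorm_ge0.
move=> t tab; apply: bnd => //; rewrite -ler_pdivrMr ?divr_gt0 // ltW //.
apply: le_lt_trans (truncnS_gt _).
by rewrite ler_pM2r ?invr_gt0 ?divr_gt0 //; case/andP: tab => _; lra.
Qed.

End AbsoluteContinuity.

(** * Lyapunov decay and the matrix inequality *)

Section Lyapunov.
Context {R : realType}.

(** The product rule yields two terms, which the symmetry of [Q] makes equal. *)
Lemma quadratic_form_derive {n} (Q : 'M[R]_n) (E : R -> 'cV[R]_n) (t : R) dE :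
  Q^T = Q -> is_derive t 1 E dE ->
  is_derive t 1 (fun s => inner (Q *m E s) (E s)) (2 * inner (Q *m E t) dE).
Proof.
move=> Qsym HE.
have /is_derive_mxP/(_ 0 0) := is_derive_mulmx
  (is_derive_trmx (is_derive_mulmxl Q HE)) HE.
rewrite mxE -/(inner _ _) -/(inner _ _) => h.
apply: (is_derive_eq h).
rewrite -{1}Qsym inner_trmx innerC; ring.
Qed.

Lemma lyapunov_cvg0 {n} (Q : 'M[R]_n) (E : R -> 'cV[R]_n) (eps : R) :
  Q^T = Q -> posdef Q -> 0 < eps -> abs_continuous_halfline E ->
  {ae @lebesgue_measure R, forall t : R, 0 <= t -> exists2 dE, is_derive t 1 E dE &
     2 * inner (Q *m E t) dE <= - eps * enorm (E t) ^+ 2} ->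
  E t @[t --> +oo] --> (0 : 'cV[R]_n).
Proof.
move=> Qsym [a a0 Qa] eps0 acE dEle.
pose V t := inner (Q *m E t) (E t).
have [c c0 Qc] := enorm_mulmx_le Q.
have V0 t : 0 <= V t by rewrite (le_trans _ (Qa _)) // mulr_ge0 ?sqr_ge0 // ltW.
have Vle t : V t <= (c + 1) * enorm (E t) ^+ 2.
  apply: le_trans (inner_le_enorm _ _) _; have := Qc (E t).
  by have := enorm_ge0 (E t); nra.
(* Since [V] is at most [c + 1] times the squared norm, this rate turns dissipation in the norm into
   dissipation in [V]. *)
pose k := eps / (c + 1).
have k0 : 0 < k by rewrite divr_gt0 // ltr_wpDl.
have kV t : - eps * enorm (E t) ^+ 2 <= - k * V t.
  rewrite !mulNr lerN2 /k mulrAC ler_pdivrMr ?ltr_wpDl //.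
  by rewrite -mulrA ler_pM2l // mulrC.
(* [K] is any upper bound of [- k * V] on [[s, T]]: it is taken to be 0 for monotonicity, then
   [- k * V t] for the decay rate. *)
have descent s T K : 0 <= s -> s <= T ->
    (forall t, s <= t -> t <= T -> - k * V t <= K) ->
    V T - V s <= K * (T - s).
  move=> s0 sT VK; have T0 := le_trans s0 sT.
  have [B B0 EB] := abs_continuous_bounded _ _ _ T0 (acE _ T0).
  (* An increment of [V] splits into two terms, each at most [c * B] times the increment of [E];
     hence the constant [2 * (c * B)]. *)
  apply: (abs_continuous_derive_le E V s T K (2 * (c * B))) => //.
  - by rewrite !mulr_ge0.
  - exact: abs_continuous_subitv (acE _ T0).
  - move=> s' t ss' s't tT.
    have -> : V t - V s' = inner (Q *m (E t - E s')) (E t) +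
        inner (Q *m E s') (E t - E s').
      by rewrite mulmxBr !(innerDl, innerDr, innerNl, innerNr) /V; ring.
    have Et : enorm (E t) <= B by apply: EB; lra.
    have Es : enorm (E s') <= B by apply: EB; lra.
    have I1 : inner (Q *m (E t - E s')) (E t) <= c * enorm (E t - E s') * B.
      by apply: le_trans (inner_le_enorm _ _) _; rewrite ler_pM ?enorm_ge0.
    have I2 : inner (Q *m E s') (E t - E s') <= c * B * enorm (E t - E s').
      apply: le_trans (inner_le_enorm _ _) _; rewrite ler_wpM2r ?enorm_ge0 //.
      by apply: le_trans (Qc _) _; rewrite ler_wpM2l.
    lra.
  - apply: negligibleS dEle; apply: subsetC => t h /andP[st tT].
    have [dE dE1 dE2] := h (le_trans s0 st).
    exists (2 * inner (Q *m E t) dE); first exact: quadratic_form_derive.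
    exact: le_trans dE2 (le_trans (kV t) (VK t st tT)).
have Vni s t : 0 <= s -> s <= t -> V t <= V s.
  move=> s0 st; have := descent s t 0 s0 st; rewrite mul0r subr_le0; apply.
  by move=> r _ _; rewrite mulNr oppr_le0 mulr_ge0 // ltW.
have decay t : 0 <= t -> V t * (1 + k * t) <= V 0.
  move=> t0; have := descent 0 t (- k * V t) (lexx 0) t0; rewrite subr0.
  suff h : forall r, 0 <= r -> r <= t -> - k * V r <= - k * V t.
    by move=> /(_ h); lra.
  by move=> r r0 rt; rewrite !mulNr lerN2 ler_pM2l // Vni.
apply/cvgr0Pnorm_lt => e e0; near=> t.
apply: le_lt_trans (norm_le_enorm _) _.
have t0 : 0 < t by near: t; exact: nbhs_pinfty_gt.
(* Past this time, [e <= enorm (E t)] would make [a * e ^+ 2 * (1 + k * t)] exceed [V 0], against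
   [decay]. *)
have tbig : V 0 / (a * e ^+ 2) / k < t by near: t; apply: nbhs_pinfty_gt; exact: num_real.
rewrite ltNge; apply/negP => eE.
have : a * e ^+ 2 * (1 + k * t) <= V 0.
  apply: le_trans (decay t (ltW t0)); rewrite ler_wpM2r //.
    by apply: addr_ge0 => //; apply: mulr_ge0; exact: ltW.
  apply: le_trans (Qa _); rewrite ler_pM2l // ler_pXn2r ?nnegrE ?enorm_ge0 //.
  exact: ltW.
have ae0 : 0 < a * e ^+ 2 by rewrite mulr_gt0 // exprn_gt0.
move: tbig; rewrite ltr_pdivrMr // ltr_pdivrMr //.
move: (a * e ^+ 2) ae0 => w w0; lra.
Unshelve. all: by end_near. Qed.

(** With [G = (K I)], [K *m K^T + 1%:M] is [G *m G^T], so the matrix inequality tested at [e] offers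
    exactly the two squares, of [G^T *m (Q *m e)] and of [e], that dominate the Lipschitz cross
    term, with [eps] to spare. *)
Lemma lmi_dissipation {q p m} (K : 'M[R]_(p, q)) (N Q : 'M[R]_p)
    (B : 'M[R]_(p, m)) (L eps : R) (e : 'cV[R]_p) (w : 'cV[R]_m)
    (df : 'cV[R]_(q + p)) :
  Q^T = Q -> 0 <= L ->
  negsemidef (Q *m N + N^T *m Q + L *: (Q *m (K *m K^T + 1%:M) *m Q)
              + (L + eps)%:M) ->
  inner w (B^T *m Q *m e) <= 0 -> enorm df <= L * enorm e ->
  2 * inner (Q *m e) (N *m e + B *m w + row_mx K 1%:M *m df)
    <= - eps * enorm e ^+ 2.
Proof.
move=> Qsym L0 /(_ e) lmi wB dfL.
set G := row_mx K 1%:M.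
have GG : K *m K^T + 1%:M = G *m G^T.
  by rewrite /G tr_row_mx mul_row_col trmx1 mulmx1.
have QE v : inner (Q *m v) e = inner (Q *m e) v.
  by rewrite -{1}Qsym inner_trmx innerC.
have {lmi} : 2 * inner (Q *m e) (N *m e) + L * enorm (G^T *m (Q *m e)) ^+ 2
    + (L + eps) * enorm e ^+ 2 <= 0.
  move: lmi; rewrite GG !mulmxDl !innerDl -scalemxAl innerZl mul_scalar_mx innerZl.
  rewrite -!mulmxA !QE inner_trmx -(inner_trmx G) -!enorm_sqr; lra.
have wB' : inner (Q *m e) (B *m w) <= 0 by rewrite -inner_trmx innerC mulmxA.
have : inner (Q *m e) (G *m df) <= enorm (G^T *m (Q *m e)) * (L * enorm e).
  rewrite -inner_trmx (le_trans (inner_le_enorm _ _)) //.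
  by rewrite ler_wpM2l ?enorm_ge0.
(* AM-GM on the cross term *)
have := mulr_ge0 L0 (sqr_ge0 (enorm (G^T *m (Q *m e)) - enorm e)).
rewrite !innerDr; nra.
Qed.

End Lyapunov.

(** * The error equation of the observer and its convergence *)

Theorem theorem6 (R : realType) (q p m r l : nat)
  (A : 'M[R]_(q + p)) (B : 'M[R]_(q + p, m)) (C : 'M[R]_(m, q + p))
  (F : 'M[R]_(q, q + p)) (Fq : 'M[R]_q)
  (calF : 'cV[R]_m -> set 'cV[R]_m)
  (f1 : 'cV[R]_(q + p) -> 'cV[R]_r -> 'cV[R]_(q + p))
  (f2 : 'cV[R]_(q + p) -> 'cV[R]_r -> 'M[R]_(q + p, l))
  (theta : R -> 'cV[R]_l) (u : R -> 'cV[R]_r)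
  (L1 L2 L3 eps : R) (Q P22 : 'M[R]_p) (P21 : 'M[R]_(p, q))
  (x : R -> 'cV[R]_(q + p)) (y : R -> 'cV[R]_q) (omega : R -> 'cV[R]_m)
  (z : R -> 'cV[R]_p) (omega' : R -> 'cV[R]_m) :
  let K := invmx P22 *m P21 in
  let A11 := ulsubmx A in let A12 := ursubmx A in
  let A21 := dlsubmx A in let A22 := drsubmx A in
  let B1 := usubmx B in let B2 := dsubmx B in
  let C1 := lsubmx C in let C2 := rsubmx C in
  let x1 := fun t => usubmx (x t) in
  let x2 := fun t => dsubmx (x t) in
  let x2' := fun t => z t - K *m x1 t in
  F = row_mx Fq 0 -> Fq \in unitmx ->
  admissible_map calF ->
  admissible_nonlinearities f1 f2 L1 L2 ->
  bounded_signal theta L3 ->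
  observer_lmi A B C f2 L1 eps Q P22 P21 ->
  (* the plant *)
  abs_continuous_halfline x ->
  {ae @lebesgue_measure R, forall t : R, 0 <= t ->
     calF (C *m x t) (- omega t) /\
     is_derive t 1 x
       (A *m x t + B *m omega t + f1 (x t) (u t) + f2 (x t) (u t) *m theta t)} ->
  (forall t : R, 0 <= t -> y t = F *m x t) ->
  (* the observer *)
  abs_continuous_halfline z ->
  {ae @lebesgue_measure R, forall t : R, 0 <= t ->
     calF (C2 *m z t + (C1 - C2 *m K) *m x1 t) (- omega' t) /\
     is_derive t 1 z
       ((A22 + K *m A12) *m z t + (B2 + K *m B1) *m omega' t
        + ((A21 + K *m A11) - (A22 + K *m A12) *m K) *m x1 t
        + row_mx K 1%:M *m f1 (col_mx (x1 t) (x2' t)) (u t))} ->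
  (x2 t - x2' t) @[t --> +oo] --> (0 : 'cV[R]_p).
Proof.
move=> K A11 A12 A21 A22 B1 B2 C1 C2 x1 x2 x2' _ _ [Fmono _ _]
  [_ _ [L1_gt0 f1_lip] _] _ [eps_gt0 [Qsym Qpos] P22u lmi [BQ f2_ker]] acx plant _
  acz observer.
pose G := row_mx K 1%:M; pose E t := G *m x t - z t.
have xE t : x t = col_mx (x1 t) (x2 t) by rewrite vsubmxK.
have EE t : E t = K *m x1 t + x2 t - z t.
  by rewrite /E {1}xE mul_row_col mul1mx.
have EE' t : E t = x2 t - x2' t by rewrite EE opprB addrA [x2 t + _]addrC.
(* [G] is [invmx P22] times the row that annihilates [f2]. *)
have Gf2 v w : G *m f2 v w = 0.
  have -> : G = invmx P22 *m row_mx P21 P22 by rewrite mul_mx_row mulVmx.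
  by rewrite -mulmxA f2_ker mulmx0.
have GA : G *m A = row_mx (A21 + K *m A11) (A22 + K *m A12).
  rewrite -{1}(submxK A) mul_row_block !mul1mx.
  by rewrite [in LHS]addrC; congr row_mx; rewrite addrC.
have GB : G *m B = B2 + K *m B1.
  by rewrite -{1}(vsubmxK B) mul_row_col mul1mx addrC.
suff : E t @[t --> +oo] --> (0 : 'cV[R]_p).
  by apply: cvg_trans; under eq_fun do rewrite -EE'.
(* Absolute continuity of [E] comes first: [E] is Lipschitz in the pair of [x] and [z]. Its
   derivative is then treated at times where both the plant and the observer equations hold. *)
apply: (lyapunov_cvg0 Q E eps) => //.
  have [c c0 Gc] := enorm_mulmx_le G.
  move=> T T0; apply: (abs_continuous_lipschitz2 x z E 0 T (c + 1)).
  - exact: addr_ge0.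
  - move=> s t.
    have -> : E t - E s = G *m (x t - x s) + - (z t - z s).
      by rewrite /E mulmxBr opprD addrACA -opprD.
    apply: le_trans (enormD _ _) _; rewrite enormN.
    have := Gc (x t - x s); have := enorm_ge0 (x t - x s).
    have := mulr_ge0 c0 (enorm_ge0 (z t - z s)); lra.
  - exact: acx.
  - exact: acz.
have ae2 := negligibleU plant observer.
apply: negligibleS ae2; rewrite -setCI; apply: subsetC => t [Hx Hz] t0.
have {Hx} [Fx dx] := Hx t0; have {Hz} [Fz dz] := Hz t0.
pose df := f1 (x t) (u t) - f1 (col_mx (x1 t) (x2' t)) (u t).
exists ((A22 + K *m A12) *m E t + (B2 + K *m B1) *m (omega t - omega' t)
        + G *m df).
  apply: (is_derive_eq (is_deriveB (is_derive_mulmxl G dx) dz)).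
  rewrite /df EE !mulmxDr !mulmxN [_ *m (f2 _ _ *m _)]mulmxA Gf2 mul0mx addr0.
  rewrite [_ *m (A *m x t)]mulmxA GA [in row_mx _ _ *m x t]xE mul_row_col.
  rewrite [_ *m (B *m omega t)]mulmxA GB -/G.
  (* Abstracting the matrix products leaves a linear identity between vectors, settled coordinate by
     coordinate. *)
  move: (A22 + _) (A21 + _) (B2 + _) (_ *m f1 _ _) (_ *m f1 _ _).
  move=> N N' B' g g'.
  rewrite mulmxBl -mulmxA.
  move: (N *m (_ *m _)) (N *m x2 t) (N *m z t) (N' *m _) (B' *m _) (B' *m _).
  by move=> *; apply/matrixP => i j; rewrite !mxE; ring.
apply: (lmi_dissipation K _ Q _ L1 eps) => //; first exact: ltW.
  rewrite BQ -/C2.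
  (* [C2 *m E t] is the difference of the points at which [calF] is evaluated in the plant and in
     the observer, so monotonicity gives the sign. *)
  have -> : C2 *m E t = C *m x t - (C2 *m z t + (C1 - C2 *m K) *m x1 t).
    rewrite EE -{1}(hsubmxK C) -/C1 -/C2 [in RHS]xE mul_row_col.
    rewrite mulmxBl mulmxBr mulmxDr -[C2 *m K *m _]mulmxA.
    move: (C2 *m (_ *m _)) (C2 *m _) (C2 *m _) (C1 *m _).
    by move=> *; apply/matrixP => i j; rewrite !mxE; ring.
  by have := Fmono _ _ _ _ Fx Fz; rewrite opprK addrC -opprB innerNl oppr_ge0.
(* The two arguments of [f1] share their first block, so their distance is exactly the norm of
   [E t]. *)
have -> : enorm (E t) = enorm (x t - col_mx (x1 t) (x2' t)).
  by rewrite {1}xE opp_col_mx add_col_mx subrr enorm_col_mx0 EE'.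
exact: f1_lip.
Qed.
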